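(* Let the data, standing assumptions, mesh and operators $\mathcal S_{n,i}^{a,b}$, $S_{n,i}$, $\mathcal S_{n,i}^{\partial,b}$, $S_{n,i}^{\partial}$ be as in the context (with $\Delta t$ and $h$ small enough that these are defined and the boundary system is uniquely solvable). Let $V\le W$ be two grid functions (componentwise). Then for every $n=0,\dots,N_T-1$: $$\mathcal S_{n,i}^{a,b}[V]\le\mathcal S_{n,i}^{a,b}[W],\qquad S_{n,i}[V]\le S_{n,i}[W]\qquad(i\in\mathcal I_h^\circ,\ (a,b)\in A\times B),$$ $$\mathcal S_{n,i}^{\partial,b}[V]\le\mathcal S_{n,i}^{\partial,b}[W],\qquad S_{n,i}^{\partial}[V]\le S_{n,i}^{\partial}[W]\qquad(i\in\mathcal I_h^\partial,\ b\in B).$$ Consequently, one complete backward time-layer update (the map sending a grid vector at level $n+1$ to the grid vector at level $n$ defined by the scheme) is order preserving. Moreover, for every constant $c\ge0$, $$S_{n,i}[V+c]\le S_{n,i}[V]+c\quad(i\in\mathcal I_h^\circ),\qquad S_{n,i}^{\partial}[V+c]\le S_{n,i}^{\partial}[V]+c\quad(i\in\mathcal I_h^\partial).$$ If $f$, $g$ and $\Psi$ are nonnegative, then the discrete solution is nonnegative, i.e. $U_i^n\ge0$ for all $0\le n\le N_T$ and $i\in\mathcal I_h$.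
   Context: **Data and standing assumptions.** $T>0$; $\mathcal O\subset\mathbb R^N$ is a nonempty bounded domain with boundary of class $C^3$; $n(x)$ is the unit outward normal at $x\in\partial\mathcal O$; $A\subset\mathbb R^{N_A}$, $B\subset\mathbb R^{N_B}$ are nonempty compact sets; $1\le N_p\le N$. The functions $\sigma:[0,T]\times\overline{\mathcal O}\times A\to\mathbb R^{N\times N_p}$, $\mu:[0,T]\times\overline{\mathcal O}\times A\to\mathbb R^N$, $f,r:[0,T]\times\overline{\mathcal O}\times A\to\mathbb R$, $g,k:[0,T]\times\partial\mathcal O\times B\to\mathbb R$, $\Psi:\overline{\mathcal O}\to\mathbb R$ are continuous; $\sigma(\cdot,\cdot,a)$ and $\mu(\cdot,\cdot,a)$ are Lipschitz with constants independent of $a\in A$; $r\ge0$ and $k\ge0$. The map $\gamma:\partial\mathcal O\times\mathcal V\to\mathbb R^N$, with $\mathcal V\subseteq\mathbb R^{N_B}$ open and $B\subset\mathcal V$, is of class $C^1$, and $|\gamma(x,b)|=1$, $\langle n(x),\gamma(x,b)\rangle>0$ for all $(x,b)\in\partial\mathcal O\times B$. Write $\gamma_b(x)=\gamma(x,b)$. **Mesh and interpolation.** For each $h$, $\mathcal O_h$ is a polyhedral approximation of $\mathcal O$ with a shape-regular simplicial triangulation $\mathbb T_h$, $h=\max_{\mathsf T\in\mathbb T_h}\operatorname{diam}\mathsf T$, whose vertices $\mathcal G_h=\{x_i:i\in\mathcal I_h\}$ lie in $\overline{\mathcal O}$; $\mathcal I_h=\mathcal I_h^\circ\,\dot\cup\,\mathcal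 I_h^\partial$ with $x_i\in\mathcal O$ for $i\in\mathcal I_h^\circ$, $x_i\in\partial\mathcal O$ for $i\in\mathcal I_h^\partial$. $\widehat{\mathbb T}_h$ is the associated exact triangulation of $\overline{\mathcal O}$ with the same vertices and possibly curved boundary elements, and $p_h:\overline{\mathcal O}\to\overline{\mathcal O_h}$ maps each element of $\widehat{\mathbb T}_h$ to the corresponding simplex of $\mathbb T_h$, fixing the vertices. With $\{\psi_j\}$ the continuous piecewise-linear nodal basis on $\mathbb T_h$, $I_h[V](x)=\sum_{j\in\mathcal I_h}\psi_j(p_h(x))V_j$ for $x\in\overline{\mathcal O}$ and a grid vector $V=(V_j)_{j\in\mathcal I_h}$. The mesh family satisfies $\|I_h[\phi|_{\mathcal G_h}]-\phi\|_{L^\infty(\overline{\mathcal O})}\le C_\phi h^2$ for all $\phi\in C^2(\overline{\mathcal O})$, where $C_\phi$ is independent of $h$ and bounded by a constant times $\|\phi\|_{C^2}$. Time grid: $\Delta t=T/N_T$, $t_n=n\Delta t$. **Oblique projection.** There are $R,\delta>0$ such that for every $x$ with $\operatorname{dist}(x,\partial\mathcal O)<R$ and every $b\in B$ there is a unique pair $(p^{\gamma_b}(x),d^{\gamma_b}(x))\in\partial\mathcal O\times(-\delta,\delta)$ with $x=p^{\gamma_b}(x)+d^{\gamma_b}(x)\gamma_b(p^{\gamma_b}(x))$; both are $C^1$ in $(x,b)$. For exterior points sufficiently close to $\partial\mathcal O$ one has $d^{\gamma_b}(x)>0$. **Branches.** Let $m=N_p$, $P=2^m$, and let $\xi^1,\dots,\xi^P$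 be the elements of $\{-1,1\}^m$. For $i\in\mathcal I_h^\circ$, $a\in A$, $b\in B$ put $X^{*,p}=x_i+\Delta t\,\mu(t_n,x_i,a)+\sqrt{\Delta t}\,\sigma(t_n,x_i,a)\xi^p$. If $X^{*,p}\in\overline{\mathcal O}$, set $\widetilde X_p=X^{*,p}$ and $\widetilde d_p=\widetilde k_p=\widetilde g_p=0$. If $X^{*,p}\notin\overline{\mathcal O}$, set $x_b^p=p^{\gamma_b}(X^{*,p})$, $\widetilde d_p=2d^{\gamma_b}(X^{*,p})$, $\widetilde X_p=X^{*,p}-\widetilde d_p\gamma_b(x_b^p)$, $\widetilde k_p=k(t_n,x_b^p,b)$, $\widetilde g_p=g(t_n,x_b^p,b)$. For $\Delta t$ small enough (only such $\Delta t$ are considered) these are well defined with $\widetilde d_p\ge0$ and $\widetilde X_p\in\overline{\mathcal O}$. **Scheme.** For a grid vector $V$ and $i\in\mathcal I_h^\circ$, $$\mathcal S_{n,i}^{a,b}[V]=\frac{1}{1+r(t_n,x_i,a)\Delta t}\frac1P\sum_{p=1}^P\big[e^{-\widetilde k_p\widetilde d_p}I_h[V](\widetilde X_p)+\widetilde d_pe^{-\widetilde k_p\widetilde d_p/2}\widetilde g_p\big]+\Delta t\,f(t_n,x_i,a),\qquad S_{n,i}[V]=\inf_{(a,b)\in A\times B}\mathcal S_{n,i}^{a,b}[V].$$ Fix constants $0<c_0\le c_1$ and an offset $\ell_h$, independent of $\Delta t$, with $c_0h\le\ell_h\le c_1h$. For $i\in\mathcal I_h^\partial$ (and $h$ small,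 so that $x_i-\ell_h\gamma(x_i,b)\in\mathcal O$), $$\mathcal S_{n,i}^{\partial,b}[V]=\frac{I_h[V](x_i-\ell_h\gamma(x_i,b))+\ell_hg(t_n,x_i,b)}{1+\ell_hk(t_n,x_i,b)},\qquad S_{n,i}^{\partial}[V]=\inf_{b\in B}\mathcal S_{n,i}^{\partial,b}[V].$$ The discrete solution is defined by $U_i^{N_T}=\Psi(x_i)$ for $i\in\mathcal I_h$ and, for $n=N_T-1,\dots,0$, $U_i^n=S_{n,i}[U^{n+1}]$ for $i\in\mathcal I_h^\circ$, and then $U_i^n=S_{n,i}^\partial[U^n]$ for $i\in\mathcal I_h^\partial$ (a same-level system for the boundary values; for small $h$ its right-hand side is a sup-norm contraction in the boundary values, so it is uniquely solvable). *)

(* Defs.v *)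
From HB Require Import structures.
From mathcomp Require Import all_boot all_order all_algebra.
From mathcomp Require Import all_classical all_reals all_analysis.

Set Implicit Arguments.
Unset Strict Implicit.
Unset Printing Implicit Defensive.

Import Order.TTheory GRing.Theory Num.Theory.
Import numFieldNormedType.Exports.

Local Open Scope classical_set_scope.
Local Open Scope ring_scope.

(* The norm `|x| of the library on 'cV[R]_N is the maximum norm: it induces
   the right topology, but lengths and distances are Euclidean here. *)

Section Euclidean.
Context {R : realType} {N : nat}.
Implicit Types (x y : 'cV[R]_N) (S : set 'cV[R]_N).

Definition dotv x y : R := \sum_(i < N) x i 0 * y i 0.

Definition enorm x : R := Num.sqrt (dotv x x).

Definition dist_to x S : R := inf [set enorm (x - y) | y in S].

Definition diam S : R :=
  sup [set z | exists x y, [/\ S x, S y & z = enorm (x - y)]].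

Definition bdry S : set 'cV[R]_N := closure S `\` S°.

Definition basis_vec (i : 'I_N) : 'cV[R]_N := delta_mx i 0.

Definition grad (rho : 'cV[R]_N -> R) x : 'cV[R]_N :=
  \col_i 'D_(basis_vec i) rho x.

End Euclidean.

Section Smoothness.
Context {R : realType}.

(* f is of class C^k on the open set U; V and W are finite-dimensional in all
   uses, so continuity of the differential is continuity of all directional
   derivatives. *)
Fixpoint Ck_on (V W : normedModType R) (k : nat) (U : set V) (f : V -> W)
    : Prop :=
  match k with
  | 0%N => forall x, U x -> {for x, continuous f}
  | k'.+1 => (forall x, U x -> differentiable f x) /\
             (forall v, Ck_on k' U ('D_v f))
  end.

(* Class C^1 on a set E that need not be open (a hypersurface times an open
   set, or an open set times a compact one): locally the restriction of a C^1
   map defined on an open set. *)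
Definition C1_on_set (V W : normedModType R) (E : set V) (f : V -> W) : Prop :=
  forall x, E x -> exists (U : set V) (F : V -> W),
    [/\ open U, U x, Ck_on 1 U F & forall y, U y -> E y -> F y = f y].

Context {N : nat}.
Implicit Types (O : set 'cV[R]_N) (phi : 'cV[R]_N -> R).

Definition extends_continuously O phi : Prop :=
  exists phi' : 'cV[R]_N -> R,
    {within closure O, continuous phi'} /\ forall x, O x -> phi' x = phi x.

Definition C2_closure O phi : Prop :=
  [/\ Ck_on 2 O phi,
      {within closure O, continuous phi},
      forall v, extends_continuously O ('D_v phi) &
      forall v w, extends_continuously O ('D_w ('D_v phi))].

Definition C2_norm O phi : R :=
  sup [set y | exists2 x, O x &
    [\/ y = `|phi x|,
        exists i, y = `|'D_(basis_vec i) phi x| |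
        exists i j, y = `|'D_(basis_vec j) ('D_(basis_vec i) phi) x| ]].

Definition C3_defining_function O (x : 'cV[R]_N) (U : set 'cV[R]_N)
    (rho : 'cV[R]_N -> R) : Prop :=
  [/\ open U /\ U x,
      Ck_on 3 U rho,
      forall y, U y -> grad rho y != 0,
      forall y, U y -> (O y <-> rho y < 0) &
      forall y, U y -> (bdry O y <-> rho y = 0)].

Definition C3_boundary O : Prop :=
  forall x, bdry O x -> exists U rho, C3_defining_function O x U rho.

Definition outward_unit_normal O (n : 'cV[R]_N -> 'cV[R]_N) : Prop :=
  forall x, bdry O x -> exists U rho,
    C3_defining_function O x U rho /\
    n x = (enorm (grad rho x))^-1 *: grad rho x.

End Smoothness.

(* Data of the problem. All maps are total; only their values on the domains
   given in the standing assumptions matter. *)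
Record data (R : realType) (N Np NA NB : nat) := Data {
  horizon : R;
  dom : set 'cV[R]_N;
  normal : 'cV[R]_N -> 'cV[R]_N;
  ctrlA : set 'cV[R]_NA;
  ctrlB : set 'cV[R]_NB;
  ctrlV : set 'cV[R]_NB;
  sigma : R -> 'cV[R]_N -> 'cV[R]_NA -> 'M[R]_(N, Np);
  mu : R -> 'cV[R]_N -> 'cV[R]_NA -> 'cV[R]_N;
  fA : R -> 'cV[R]_N -> 'cV[R]_NA -> R;
  rA : R -> 'cV[R]_N -> 'cV[R]_NA -> R;
  gB : R -> 'cV[R]_N -> 'cV[R]_NB -> R;
  kB : R -> 'cV[R]_N -> 'cV[R]_NB -> R;
  Psi : 'cV[R]_N -> R;
  gamma : 'cV[R]_N -> 'cV[R]_NB -> 'cV[R]_N }.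

Section Assumptions.
Context {R : realType} {N Np NA NB : nat}.
Variable D : data R N Np NA NB.

Definition time_ok (t : R) : Prop := 0 <= t <= horizon D.

Definition cylA : set (R * 'cV[R]_N * 'cV[R]_NA) :=
  [set z | [/\ time_ok z.1.1, closure (dom D) z.1.2 & ctrlA D z.2]].

Definition cylB : set (R * 'cV[R]_N * 'cV[R]_NB) :=
  [set z | [/\ time_ok z.1.1, bdry (dom D) z.1.2 & ctrlB D z.2]].

Definition uniformly_lipschitz m p
    (F : R -> 'cV[R]_N -> 'cV[R]_NA -> 'M[R]_(m, p)) : Prop :=
  exists L : R, forall a, ctrlA D a ->
    forall s t x y, time_ok s -> time_ok t ->
      closure (dom D) x -> closure (dom D) y ->
      `|F s x a - F t y a| <= L * (`|s - t| + enorm (x - y)).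

Record standing_assumptions : Prop := StandingAssumptions {
  sa_horizon : 0 < horizon D;
  sa_dim : (1 <= Np <= N)%N;
  sa_dom_nonempty : dom D !=set0;
  sa_dom_bounded : bounded_set (dom D);
  sa_dom_open : open (dom D);
  sa_dom_connected : connected (dom D);
  sa_dom_C3 : C3_boundary (dom D);
  sa_normal : outward_unit_normal (dom D) (normal D);
  sa_A_nonempty : ctrlA D !=set0;
  sa_A_compact : compact (ctrlA D);
  sa_B_nonempty : ctrlB D !=set0;
  sa_B_compact : compact (ctrlB D);
  sa_sigma_cont :
    {within cylA, continuous (fun z => sigma D z.1.1 z.1.2 z.2)};
  sa_mu_cont : {within cylA, continuous (fun z => mu D z.1.1 z.1.2 z.2)};
  sa_f_cont : {within cylA, continuous (fun z => fA D z.1.1 z.1.2 z.2)};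
  sa_r_cont : {within cylA, continuous (fun z => rA D z.1.1 z.1.2 z.2)};
  sa_g_cont : {within cylB, continuous (fun z => gB D z.1.1 z.1.2 z.2)};
  sa_k_cont : {within cylB, continuous (fun z => kB D z.1.1 z.1.2 z.2)};
  sa_Psi_cont : {within closure (dom D), continuous (Psi D)};
  sa_sigma_lip : uniformly_lipschitz (sigma D);
  sa_mu_lip : uniformly_lipschitz (mu D);
  sa_r_ge0 : forall t x a, cylA (t, x, a) -> 0 <= rA D t x a;
  sa_k_ge0 : forall t x b, cylB (t, x, b) -> 0 <= kB D t x b;
  sa_V_open : open (ctrlV D);
  sa_B_sub_V : ctrlB D `<=` ctrlV D;
  sa_gamma_C1 :
    C1_on_set (bdry (dom D) `*` ctrlV D) (fun z => gamma D z.1 z.2);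
  sa_gamma_unit : forall x b, bdry (dom D) x -> ctrlB D b ->
    enorm (gamma D x b) = 1;
  sa_gamma_out : forall x b, bdry (dom D) x -> ctrlB D b ->
    0 < dotv (normal D x) (gamma D x b) }.

End Assumptions.

Record oblique_proj (R : realType) (N NB : nat) := ObliqueProj {
  op_R : R;
  op_delta : R;
  op_p : 'cV[R]_NB -> 'cV[R]_N -> 'cV[R]_N;
  op_d : 'cV[R]_NB -> 'cV[R]_N -> R }.

Section ObliqueProjection.
Context {R : realType} {N Np NA NB : nat}.
Variables (D : data R N Np NA NB) (Q : oblique_proj R N NB).

Definition near_bdry (e : R) : set 'cV[R]_N :=
  [set x | dist_to x (bdry (dom D)) < e].

Definition oblique_decomp (b : 'cV[R]_NB) (x y : 'cV[R]_N) (d : R) : Prop :=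
  [/\ bdry (dom D) y, - op_delta Q < d < op_delta Q & x = y + d *: gamma D y b].

Record oblique_projection : Prop := ObliqueProjection {
  op_R_gt0 : 0 < op_R Q;
  op_delta_gt0 : 0 < op_delta Q;
  op_exists : forall x b, near_bdry (op_R Q) x -> ctrlB D b ->
    oblique_decomp b x (op_p Q b x) (op_d Q b x);
  op_unique : forall x b y d, near_bdry (op_R Q) x -> ctrlB D b ->
    oblique_decomp b x y d -> y = op_p Q b x /\ d = op_d Q b x;
  op_p_C1 : C1_on_set (near_bdry (op_R Q) `*` ctrlB D)
    (fun z => op_p Q z.2 z.1);
  op_d_C1 : C1_on_set (near_bdry (op_R Q) `*` ctrlB D)
    (fun z => op_d Q z.2 z.1);
  op_d_exterior : exists2 e : R, 0 < e <= op_R Q & forall x b,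
    ~ closure (dom D) x -> near_bdry e x -> ctrlB D b -> 0 < op_d Q b x }.

End ObliqueProjection.

(* A mesh with nodal basis [nodal]; simplices are given by their vertex sets.
   [curved S] is the (possibly curved) element of the exact triangulation with
   the same vertices as the simplex S, and [to_poly] is the map p_h. *)
Record mesh (R : realType) (N : nat) := Mesh {
  nv : nat;
  vtx : 'I_nv -> 'cV[R]_N;
  simplices : {set {set 'I_nv}};
  nodal : 'I_nv -> 'cV[R]_N -> R;
  curved : {set 'I_nv} -> set 'cV[R]_N;
  to_poly : 'cV[R]_N -> 'cV[R]_N }.

Arguments vtx {R N} M i : rename.
Arguments nodal {R N} M j x : rename.
Arguments curved {R N} M S : rename.
Arguments to_poly {R N} M x : rename.

Section Mesh.
Context {R : realType} {N : nat}.
Variables (O : set 'cV[R]_N) (M : mesh R N).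

Definition hull (S : {set 'I_(nv M)}) : set 'cV[R]_N :=
  [set x | exists w : 'I_(nv M) -> R,
    [/\ forall i, 0 <= w i, \sum_(i in S) w i = 1 &
        x = \sum_(i in S) w i *: vtx M i]].

Definition affinely_independent (S : {set 'I_(nv M)}) : Prop :=
  forall w : 'I_(nv M) -> R, \sum_(i in S) w i = 0 ->
    \sum_(i in S) w i *: vtx M i = 0 -> forall i, i \in S -> w i = 0.

Definition polyhedron : set 'cV[R]_N :=
  [set x | exists2 S, S \in simplices M & hull S x].

Definition mesh_size : R := \big[Num.max/0]_(S in simplices M) diam (hull S).

Definition triangulation : Prop :=
  [/\ injective (vtx M),
      forall S, S \in simplices M -> #|S| = N.+1 /\ affinely_independent S,
      forall S S', S \in simplices M -> S' \in simplices M ->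
        hull S `&` hull S' = hull (S :&: S') &
      forall i, exists2 S, S \in simplices M & i \in S].

Definition nodal_basis : Prop :=
  [/\ forall j, {within polyhedron, continuous (nodal M j)},
      forall j S, S \in simplices M -> exists (l : 'rV[R]_N) (c : R),
        forall x, hull S x -> nodal M j x = (l *m x) 0 0 + c &
      forall i j, nodal M j (vtx M i) = (i == j)%:R].

Definition exact_triangulation : Prop :=
  [/\ forall S, S \in simplices M ->
        closed (curved M S) /\ (forall i, curved M S (vtx M i) <-> i \in S),
      closure O = [set x | exists2 S, S \in simplices M & curved M S x],
      forall S S', S \in simplices M -> S' \in simplices M -> S != S' ->
        (curved M S)° `&` (curved M S')° = set0 &
      forall S, S \in simplices M -> (forall i, i \in S -> O (vtx M i)) ->
        curved M S = hull S].

Definition poly_map : Prop :=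
  (forall S, S \in simplices M -> to_poly M @` curved M S = hull S) /\
  (forall i : 'I_(nv M), to_poly M (vtx M i) = vtx M i).

Definition interp (V : 'I_(nv M) -> R) (x : 'cV[R]_N) : R :=
  \sum_(j < nv M) nodal M j (to_poly M x) * V j.

(* The vertices lie in the closure of the open set O, so these two predicates
   partition the indices into I_h^o and I_h^bdry. *)
Definition interior_node (i : 'I_(nv M)) : Prop := O (vtx M i).
Definition boundary_node (i : 'I_(nv M)) : Prop := bdry O (vtx M i).

End Mesh.

Record mesh_family (R : realType) (N : nat) (O : set 'cV[R]_N) (H : set R)
    (Mh : R -> mesh R N) : Prop := MeshFamily {
  mf_gt0 : forall h, H h -> 0 < h;
  mf_size : forall h, H h -> h = mesh_size (Mh h);
  mf_triangulation : forall h, H h -> triangulation (Mh h);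
  mf_vertices : forall h, H h -> forall i, closure O (vtx (Mh h) i);
  mf_nodal : forall h, H h -> nodal_basis (Mh h);
  mf_exact : forall h, H h -> exact_triangulation O (Mh h);
  mf_poly_map : forall h, H h -> poly_map (Mh h);
  mf_shape_regular : exists2 kappa : R, 0 < kappa &
    forall h, H h -> forall S, S \in simplices (Mh h) ->
      exists (c : 'cV[R]_N) (rho : R),
        [/\ 0 < rho, (forall y, enorm (y - c) <= rho -> hull S y) &
            diam (hull S) <= kappa * rho];
  mf_interp_error : exists K : R, forall phi : 'cV[R]_N -> R,
    C2_closure O phi -> exists2 Cphi : R, Cphi <= K * C2_norm O phi &
      forall h, H h -> forall x, closure O x ->
        `|interp (fun i : 'I_(nv (Mh h)) => phi (vtx (Mh h) i)) x - phi x|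
          <= Cphi * h ^+ 2 }.

Section Scheme.
Context {R : realType} {N Np NA NB : nat}.
Variables (D : data R N Np NA NB) (Q : oblique_proj R N NB) (M : mesh R N).
(* dt is the time step, ell the boundary offset for the mesh M. *)
Variables (dt ell : R).
Implicit Types (V U : 'I_(nv M) -> R) (i : 'I_(nv M)).

Local Notation branch := {ffun 'I_Np -> bool}.

Definition tgrid (n : nat) : R := n%:R * dt.

(* The 2 ^ Np elements of {-1, 1}^Np, indexed by sign patterns. *)
Definition xi (s : branch) : 'cV[R]_Np := \col_j (-1) ^+ s j.

Definition Xstar n i a (s : branch) : 'cV[R]_N :=
  vtx M i + dt *: mu D (tgrid n) (vtx M i) a
  + Num.sqrt dt *: (sigma D (tgrid n) (vtx M i) a *m xi s).

Definition inside (x : 'cV[R]_N) : bool := `[< closure (dom D) x >].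

Definition xb n i a b s : 'cV[R]_N := op_p Q b (Xstar n i a s).

Definition dtil n i a b s : R :=
  if inside (Xstar n i a s) then 0 else 2 * op_d Q b (Xstar n i a s).

Definition Xtil n i a b s : 'cV[R]_N :=
  if inside (Xstar n i a s) then Xstar n i a s
  else Xstar n i a s - dtil n i a b s *: gamma D (xb n i a b s) b.

Definition ktil n i a b s : R :=
  if inside (Xstar n i a s) then 0 else kB D (tgrid n) (xb n i a b s) b.

Definition gtil n i a b s : R :=
  if inside (Xstar n i a s) then 0 else gB D (tgrid n) (xb n i a b s) b.

Definition S_ab n i a b V : R :=
  (1 + rA D (tgrid n) (vtx M i) a * dt)^-1 *
  ((2 ^ Np)%:R^-1 *
   \sum_(s : branch)
      (expR (- (ktil n i a b s * dtil n i a b s)) * interp V (Xtil n i a b s)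
       + dtil n i a b s * expR (- (ktil n i a b s * dtil n i a b s / 2))
         * gtil n i a b s))
  + dt * fA D (tgrid n) (vtx M i) a.

Definition S_int n i V : R :=
  inf [set z | exists a b, [/\ ctrlA D a, ctrlB D b & z = S_ab n i a b V]].

Definition S_bd_b n i b V : R :=
  (interp V (vtx M i - ell *: gamma D (vtx M i) b)
   + ell * gB D (tgrid n) (vtx M i) b)
  / (1 + ell * kB D (tgrid n) (vtx M i) b).

Definition S_bd n i V : R := inf [set S_bd_b n i b V | b in ctrlB D].

(* U solves the same-level boundary system at level n with the interior values
   of Z. *)
Definition boundary_solution n (Z U : 'I_(nv M) -> R) : Prop :=
  (forall i, interior_node (dom D) i -> U i = Z i) /\
  (forall i, boundary_node (dom D) i -> U i = S_bd n i U).

(* The backward update from level n + 1 to level n; under unique solvability of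
   the boundary system the set below is a singleton. *)
Definition layer_update n V : 'I_(nv M) -> R :=
  xget V [set U | boundary_solution n (fun i => S_int n i V) U].

Definition discrete_solution (NT : nat) (U : nat -> 'I_(nv M) -> R) : Prop :=
  (forall i, U NT i = Psi D (vtx M i)) /\
  (forall n, (n < NT)%N ->
     (forall i, interior_node (dom D) i -> U n i = S_int n i (U n.+1)) /\
     (forall i, boundary_node (dom D) i -> U n i = S_bd n i (U n))).

(* The three smallness requirements on dt and h. *)

Definition branches_well_defined (NT : nat) : Prop :=
  forall n i a b s, (n < NT)%N -> interior_node (dom D) i ->
    ctrlA D a -> ctrlB D b ->
    [/\ ~ closure (dom D) (Xstar n i a s) ->
          near_bdry D (op_R Q) (Xstar n i a s),
        0 <= dtil n i a b s & closure (dom D) (Xtil n i a b s)].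

Definition offsets_well_defined : Prop :=
  forall i b, boundary_node (dom D) i -> ctrlB D b ->
    dom D (vtx M i - ell *: gamma D (vtx M i) b).

Definition boundary_uniquely_solvable (NT : nat) : Prop :=
  forall n (Z : 'I_(nv M) -> R), (n < NT)%N ->
    exists! U, boundary_solution n Z U.

End Scheme.

(* Main.v *)
Require Import Defs.
From HB Require Import structures.
From mathcomp Require Import all_boot all_order all_algebra.
From mathcomp Require Import all_classical all_reals all_analysis.

Set Implicit Arguments.
Unset Strict Implicit.
Unset Printing Implicit Defensive.

Import Order.TTheory GRing.Theory Num.Theory.
Import numFieldNormedType.Exports.

Local Open Scope classical_set_scope.
Local Open Scope ring_scope.

(** Up to cost terms independent of V, every operator S of the scheme averages
    the values of V with nonnegative weights of total mass at most 1: the nodal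
    basis is a partition of unity by nonnegative functions
    ([nodal_convex_weights]), and the factors exp (- k d), 1 / (1 + r dt) and 1
    / (1 + ell k) lie in [0, 1] because d, k and r are nonnegative. Hence one
    inequality carries both the monotonicity and the addition of constants: for
    c >= 0,

      V <= W + c   implies   S V <= S W + c,

    where c = 0 is monotonicity, and V := W + c gives S (W + c) <= S W + c.

    The inequality passes to the infimum over the controls once the families
    are bounded below, an infimum over an unbounded set of reals being
    meaningless ([inf_image_leD]). By the inequality itself, comparing 0 with
    V + sum |V j|, it is enough to bound the operators below at V = 0, where
    only the terms in f and g remain; these are bounded because f and g are
    continuous on compact cylinders ([fA_lower_bound], [gB_lower_bound]) and
    the reflection length is at most 2 delta.

    The layer update and the nonnegativity involve the implicit system for the
    boundary values, of which only unique solvability is known. Its right-hand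
    side T is monotone and satisfies T (V + c) <= T V + c. A subsolution X lies
    below U + c for some constant c >= 0, where U is the solution, and T maps
    the vectors below U + c to themselves; so the supremum of the subsolutions
    below U + c is a fixed point of T, as in the Knaster-Tarski theorem. By
    uniqueness it is U, and X <= U ([post_fixed_point_le],
    [boundary_subsolution_le]). The solution of the system with data from V is
    a subsolution of the system with larger data from W, which gives
    monotonicity of the layer update; if f, g and Psi are nonnegative, then 0
    is a subsolution at each level, which gives U >= 0 by backward
    induction. *)

(** * Order-theoretic tools *)

Section OrderAndInfimum.
Context {R : realType}.

(** Comparison principle from uniqueness alone: the supremum L of the post-fixed
    points below U + c, with c large enough to include X, is a fixed point, and
    U is the only one. *)
Lemma post_fixed_point_le (I : finType) (T : (I -> R) -> I -> R)
    (U X : I -> R) :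
    (forall V W c, 0 <= c -> (forall i, V i <= W i + c) ->
       forall i, T V i <= T W i + c) ->
    T U = U -> (forall V, T V = V -> V = U) ->
  (forall i, X i <= T X i) -> forall i, X i <= U i.
Proof.
move=> Tle TU Uuniq Xpost.
have Tmono V W : (forall i, V i <= W i) -> forall i, T V i <= T W i.
  move=> VW i; rewrite -[leRHS]addr0; apply: Tle => // j.
  by rewrite addr0.
pose c := \sum_i `|X i - U i|.
have c_ge0 : 0 <= c by apply: sumr_ge0.
have Xc i : X i <= U i + c.
  rewrite -lerBlDl (le_trans (ler_norm _))// /c (bigD1 i)//= lerDl.
  exact: sumr_ge0.
pose P := [set Y : I -> R | (forall i, Y i <= U i + c) /\
                            forall i, Y i <= T Y i].
have PX : P X by [].
pose L i := sup [set Y i | Y in P].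
have Pub i : has_ubound [set Y i | Y in P].
  by exists (U i + c) => _ [Y [Yc _] <-].
have leL Y i : P Y -> Y i <= L i.
  by move=> PY; apply: (ub_le_sup (Pub i)); exists Y.
have Lle x i : (forall Y, P Y -> Y i <= x) -> L i <= x.
  move=> H; apply: ge_sup => [|_ [Y PY <-]]; last exact: H.
  by exists (X i), X.
(* The two halves of the Knaster-Tarski argument: L is post-fixed, hence so is
   T L, which must then lie below L. *)
have LTL i : L i <= T L i.
  apply: Lle => Y PY; apply: (le_trans (PY.2 i)); apply: Tmono => j.
  exact: leL.
have PTL : P (T L).
  split=> i; last exact: Tmono.
  rewrite -[in leRHS]TU; apply: Tle => // j.
  by apply: Lle => Y PY; exact: PY.1.
have TL : T L = L.
  by apply/funext => i; apply/eqP; rewrite eq_le leL//= LTL.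
by move=> i; rewrite -(Uuniq _ TL); apply: leL.
Qed.

Lemma inf_image_leD (T : Type) (P : set T) (F G : T -> R) (c : R) :
    P !=set0 -> has_lbound [set F t | t in P] ->
    (forall t, P t -> F t <= G t + c) ->
  inf [set F t | t in P] <= inf [set G t | t in P] + c.
Proof.
move=> [t0 Pt0] Flb FG; rewrite -lerBlDr; apply: lb_le_inf.
  by exists (G t0), t0.
move=> _ [t Pt <-]; rewrite lerBlDr (le_trans _ (FG _ Pt))//.
by apply: (ge_inf Flb); exists t.
Qed.

End OrderAndInfimum.

(** * Lower bounds for the continuous data *)

Section Compactness.
Context {R : realType}.

Lemma trmx_continuous m n : continuous (trmx : 'M[R]_(m, n) -> 'M[R]_(n, m)).
Proof.
move=> u A /nbhs_ballP[e /= e0 eA].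
apply/nbhs_ballP; exists e => //= v [_ uv]; apply: eA; split => // i j.
by rewrite !mxE; exact: uv.
Qed.

Lemma norm_trmx m n (A : 'M[R]_(m, n)) : `|A^T| <= `|A|.
Proof.
rewrite [leLHS]/Num.norm [leRHS]/Num.norm /= !mx_normrE.
apply/bigmax_leP; split=> [|[i j] _] /=; first exact: bigmax_ge_id.
by rewrite mxE; apply: (le_bigmax _ (fun ij => `|A ij.1 ij.2|) (j, i)).
Qed.

(** The Heine-Borel theorem for row vectors, transported along transposition. *)
Lemma cV_bounded_closed_compact n (A : set 'cV[R]_n) :
  bounded_set A -> closed A -> compact A.
Proof.
move=> [M [Mreal MA]] Acl.
have -> : A = trmx @` (trmx @^-1` A : set 'rV[R]_n).
  apply/seteqP; split=> [x Ax|_ [y Ay <-] //].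
  by exists x^T; rewrite /= trmxK.
apply: continuous_compact.
  by apply: continuous_subspaceT => x; exact: trmx_continuous.
apply: bounded_closed_compact.
  exists M; split=> // x Mx y /= /(MA _ Mx); apply: le_trans.
  by rewrite -{1}(trmxK y); exact: norm_trmx.
by apply: preimage_closed => // x _; exact: trmx_continuous.
Qed.

Lemma compact_lower_bound (T : topologicalType) (K : set T) (F : T -> R) :
    compact K -> {within K, continuous F} ->
  exists2 b : R, 0 <= b & forall x, K x -> - b <= F x.
Proof.
move=> Kc Fc.
have [M [Mreal MF]] := compact_bounded (continuous_compact Fc Kc).
exists (`|M| + 1) => [|x Kx]; first by rewrite addr_ge0.
have : `|F x| <= `|M| + 1.
  by apply: MF; [rewrite ltr_pwDr// ler_norm|exists x].
by rewrite ler_norml => /andP[].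
Qed.

Section DataBounds.
Context {N Np NA NB : nat} (D : data R N Np NA NB).
Hypothesis hD : standing_assumptions D.

Lemma closure_dom_compact : compact (closure (dom D)).
Proof.
apply: cV_bounded_closed_compact; last exact: closed_closure.
have [M [Mreal MD]] := sa_dom_bounded hD.
exists M; split=> // x Mx y cly.
have : closed [set z : 'cV[R]_N | `|z| <= x].
  apply: (@preimage_closed _ _ (fun z : 'cV[R]_N => `|z|) [set r | r <= x]).
    by move=> z _; exact: norm_continuous.
  exact: closed_le.
by move/closure_id => ->; apply: closureS cly; exact: MD.
Qed.

Lemma bdry_compact : compact (bdry (dom D)).
Proof.
rewrite /bdry setDE; apply: compact_closedI; first exact: closure_dom_compact.
by apply: open_closedC; exact: open_interior.
Qed.

Lemma cylinder_compact n (X : set 'cV[R]_N) (C : set 'cV[R]_n) :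
    compact X -> compact C ->
  compact [set z : R * 'cV[R]_N * 'cV[R]_n |
             [/\ time_ok D z.1.1, X z.1.2 & C z.2]].
Proof.
move=> Xc Cc; rewrite (_ : [set _ | _] = `[0, horizon D] `*` X `*` C).
  by do 2!apply: compact_setX => //; exact: segment_compact.
apply/seteqP; split=> [[[t x] c] [/= tok Xx Ccc]|[[t x] c] [[/= tok Xx] Ccc]].
  by split=> //; split => //=; rewrite in_itv.
by split=> //=; rewrite /time_ok; move: tok; rewrite in_itv.
Qed.

Lemma fA_lower_bound : exists2 F : R, 0 <= F &
  forall t x a, cylA D (t, x, a) -> - F <= fA D t x a.
Proof.
have Kc := cylinder_compact closure_dom_compact (sa_A_compact hD).
have [F F0 FA] := compact_lower_bound Kc (sa_f_cont hD).
by exists F => // t x a /FA.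
Qed.

Lemma gB_lower_bound : exists2 G : R, 0 <= G &
  forall t x b, cylB D (t, x, b) -> - G <= gB D t x b.
Proof.
have Kc := cylinder_compact bdry_compact (sa_B_compact hD).
have [G G0 GB] := compact_lower_bound Kc (sa_g_cont hD).
by exists G => // t x b /GB.
Qed.

End DataBounds.
End Compactness.

(** * Interpolation by convex combinations *)

Section Interpolation.
Context {R : realType} {N : nat} (O : set 'cV[R]_N) (M : mesh R N).
Hypothesis hnodal : nodal_basis M.
Hypothesis hexact : exact_triangulation O M.
Hypothesis hpoly : poly_map M.

(** A nodal function is affine on each simplex, so its value at a convex
    combination of the vertices is the same combination of its nodal values,
    that is, a barycentric coordinate. *)
Lemma nodal_hullE (S : {set 'I_(nv M)}) (w : 'I_(nv M) -> R) j :
    S \in simplices M -> (forall i, 0 <= w i) -> \sum_(i in S) w i = 1 ->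
  nodal M j (\sum_(i in S) w i *: vtx M i) = if j \in S then w j else 0.
Proof.
move=> SM w0 w1.
have hullw v : (forall i, 0 <= v i) -> \sum_(i in S) v i = 1 ->
  hull S (\sum_(i in S) v i *: vtx M i) by move=> v0 v1; exists v.
have [_ aff delta] := hnodal; have [l [c lc]] := aff j _ SM.
(* A vertex is the convex combination of S with unit weight on itself. *)
have vtxE i : i \in S -> (l *m vtx M i) 0 0 + c = (i == j)%:R.
  move=> iS; rewrite -delta lc//; exists (fun k => (k == i)%:R); split.
  - by move=> k; rewrite ler0n.
  - by rewrite (bigD1 i)//= eqxx big1 ?addr0// => k /andP[_ /negbTE->].
  - rewrite (bigD1 i)//= eqxx scale1r big1 ?addr0// => k /andP[_ /negbTE->].
    by rewrite scale0r.
rewrite lc; last exact: hullw.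
(* As the weights sum to 1, the constant term c is spread over the vertices. *)
rewrite mulmx_sumr summxE -[c]mul1r -w1 mulr_suml -big_split /=.
rewrite (eq_bigr (fun i => w i * (i == j)%:R)); last first.
  by move=> i iS; rewrite -scalemxAr mxE -mulrDr vtxE.
case: ifP => jS.
  rewrite (bigD1 j)//= eqxx mulr1 big1 ?addr0// => i /andP[_ /negbTE->].
  by rewrite mulr0.
rewrite big1// => i iS; case: eqP => [ij|]; last by rewrite mulr0.
by rewrite -ij iS in jS.
Qed.

Lemma nodal_convex_weights x : closure O x ->
  (forall j, 0 <= nodal M j (to_poly M x)) /\
  \sum_j nodal M j (to_poly M x) = 1.
Proof.
have [_ -> _ _] := hexact; move=> [S SM Sx].
have : hull S (to_poly M x) by rewrite -(hpoly.1 _ SM); exists x.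
move=> [w [w0 w1 ->]]; split=> [j|].
  by rewrite nodal_hullE//; case: ifP.
rewrite -w1 [RHS]big_mkcond; apply: eq_bigr => j _.
exact: nodal_hullE.
Qed.

Lemma interp_leD (V W : 'I_(nv M) -> R) c x :
    closure O x -> (forall j, V j <= W j + c) ->
  interp V x <= interp W x + c.
Proof.
move=> /nodal_convex_weights [w0 w1] VW.
rewrite /interp -[c in leRHS]mul1r -w1 mulr_suml -big_split /=.
by apply: ler_sum => j _; rewrite -mulrDr ler_wpM2l.
Qed.

End Interpolation.

(** * Comparison for the operators of the scheme *)

Section Comparison.
Context {R : realType} {N Np NA NB : nat}.
Variables (D : data R N Np NA NB) (Q : oblique_proj R N NB) (M : mesh R N).
Variables (dt ell : R) (NT : nat).
Hypothesis hD : standing_assumptions D.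
Hypothesis hQ : oblique_projection D Q.
Hypothesis hnodal : nodal_basis M.
Hypothesis hexact : exact_triangulation (dom D) M.
Hypothesis hpoly : poly_map M.
Hypothesis hvtx : forall i, closure (dom D) (vtx M i).
Hypothesis dt_ge0 : 0 <= dt.
Hypothesis ell_gt0 : 0 < ell.
Hypothesis htime : forall n, (n < NT)%N -> time_ok D (tgrid dt n).
Hypothesis hbranch : branches_well_defined D Q M dt NT.
Hypothesis hoffset : offsets_well_defined D M ell.

Local Notation S_ab := (S_ab D Q dt).
Local Notation S_int := (S_int D Q dt).
Local Notation S_bd_b := (S_bd_b D dt ell).
Local Notation S_bd := (S_bd D dt ell).

Lemma mean_branches (x : R) :
  (2 ^ Np)%:R^-1 * \sum_(s : {ffun 'I_Np -> bool}) x = x.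
Proof.
by rewrite sumr_const card_ffun card_bool card_ord -[x *+ _]mulr_natl mulKf.
Qed.

Section InteriorNode.
Variables (n : nat) (i : 'I_(nv M)) (a : 'cV[R]_NA) (b : 'cV[R]_NB).
Hypotheses (nNT : (n < NT)%N) (inti : interior_node (dom D) i).
Hypotheses (Aa : ctrlA D a) (Bb : ctrlB D b).

Lemma xb_cylB s : ~~ inside D (Xstar D dt n i a s) ->
  cylB D (tgrid dt n, xb D Q dt n i a b s, b).
Proof.
move=> /asboolPn out; have [near _ _] := hbranch s nNT inti Aa Bb.
by have [bdx _ _] := op_exists hQ (near out) Bb; split=> //; exact: htime.
Qed.

Lemma dtil_ge0 s : 0 <= dtil D Q dt n i a b s.
Proof. by have [] := hbranch s nNT inti Aa Bb. Qed.

Lemma dtil_le s : dtil D Q dt n i a b s <= 2 * op_delta Q.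
Proof.
rewrite /dtil; case: ifPn => [_|/asboolPn out].
  by rewrite mulr_ge0// ltW// (op_delta_gt0 hQ).
have [near _ _] := hbranch s nNT inti Aa Bb.
have [_ /andP[_ dlt] _] := op_exists hQ (near out) Bb.
by rewrite ler_pM2l// ltW.
Qed.

Lemma ktil_ge0 s : 0 <= ktil D Q dt n i a b s.
Proof.
by rewrite /ktil; case: ifPn => // out; apply: (sa_k_ge0 hD); exact: xb_cylB.
Qed.

Lemma vtx_cylA : cylA D (tgrid dt n, vtx M i, a).
Proof. by split=> //=; exact: htime. Qed.

Lemma rA_discount :
  0 <= (1 + rA D (tgrid dt n) (vtx M i) a * dt)^-1 <= 1.
Proof.
have r0 : 0 <= rA D (tgrid dt n) (vtx M i) a * dt.
  by rewrite mulr_ge0// (sa_r_ge0 hD)//; exact: vtx_cylA.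
by rewrite invr_ge0 addr_ge0//= invf_le1 ?lerDl// ltr_wpDr.
Qed.

(** Raising the values of W by c raises each branch by exp (- k d) c <= c; the
    mean over the branches and the discount factor then cannot raise the
    result by more than c. *)
Lemma S_ab_leD (V W : 'I_(nv M) -> R) c :
    0 <= c -> (forall j, V j <= W j + c) ->
  S_ab n i a b V <= S_ab n i a b W + c.
Proof.
move=> c0 VW; rewrite /Defs.S_ab addrAC lerD2r.
have /andP[r0 r1] := rA_discount.
set ro := (_ ^-1) in r0 r1 *.
(* The intermediate value adds c to every branch. *)
apply: (@le_trans _ _ (ro * ((2 ^ Np)%:R^-1 * (\sum_(s : {ffun 'I_Np -> bool})
  (expR (- (ktil D Q dt n i a b s * dtil D Q dt n i a b s))
     * interp W (Xtil D Q dt n i a b s)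
   + dtil D Q dt n i a b s
     * expR (- (ktil D Q dt n i a b s * dtil D Q dt n i a b s / 2))
     * gtil D Q dt n i a b s + c))))); last first.
  rewrite big_split/= mulrDr mean_branches mulrDr lerD2l.
  by rewrite ler_piMl.
apply: ler_wpM2l => //; apply: ler_wpM2l; first by rewrite invr_ge0.
apply: ler_sum => s _; rewrite addrAC lerD2r.
set e := expR _.
have e1 : e <= 1.
  by rewrite /e -expR0 ler_expR oppr_le0 mulr_ge0 ?ktil_ge0 ?dtil_ge0.
have e0 : 0 <= e by exact: expR_ge0.
have [_ _ Xin] := hbranch s nNT inti Aa Bb.
apply: (@le_trans _ _ (e * (interp W (Xtil D Q dt n i a b s) + c))).
  by apply: ler_wpM2l => //; exact: (interp_leD hnodal hexact hpoly).
by rewrite mulrDr lerD2l ler_piMl.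
Qed.

(** At the zero vector only the running and reflection costs remain, and the
    reflection length is at most 2 delta. With F = G = 0 the bound says that
    nonnegative costs give a nonnegative value. *)
Lemma S_ab0_ge (F G : R) : 0 <= G ->
    (forall t x a, cylA D (t, x, a) -> - F <= fA D t x a) ->
    (forall t x b, cylB D (t, x, b) -> - G <= gB D t x b) ->
  - (2 * op_delta Q * G + dt * F) <= S_ab n i a b (fun=> 0).
Proof.
move=> G0 fF gG; rewrite opprD /Defs.S_ab.
have K0 : 0 <= 2 * op_delta Q * G.
  by rewrite !mulr_ge0// ltW// (op_delta_gt0 hQ).
apply: lerD; last first.
  rewrite -mulrN; apply: ler_wpM2l => //; exact/fF/vtx_cylA.
have /andP[r0 r1] := rA_discount.
apply: (@le_trans _ _ ((1 + rA D (tgrid dt n) (vtx M i) a * dt)^-1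
   * - (2 * op_delta Q * G))).
  by rewrite mulrN lerN2 ler_piMl.
apply: ler_wpM2l => //; rewrite -[leLHS]mean_branches.
apply: ler_wpM2l; first by rewrite invr_ge0.
apply: ler_sum => s _.
rewrite /interp big1 ?mulr0 ?add0r; last by move=> j _; rewrite mulr0.
have gs : - G <= gtil D Q dt n i a b s.
  rewrite /gtil; case: ifPn => [_|out]; first by rewrite oppr_le0.
  by apply: gG; exact: xb_cylB.
set e := expR _.
have e1 : e <= 1.
  by rewrite /e -expR0 ler_expR oppr_le0 !mulr_ge0 ?ktil_ge0 ?dtil_ge0.
have e0 : 0 <= e by exact: expR_ge0.
have de0 : 0 <= dtil D Q dt n i a b s * e by rewrite mulr_ge0// dtil_ge0.
apply: (le_trans _ (ler_wpM2l de0 gs)).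
rewrite mulrN lerN2; apply: ler_wpM2r => //.
apply: (le_trans _ (dtil_le s)).
by rewrite ler_piMr// dtil_ge0.
Qed.

End InteriorNode.

Section BoundaryNode.
Variables (n : nat) (i : 'I_(nv M)) (b : 'cV[R]_NB).
Hypotheses (nNT : (n < NT)%N) (bdi : boundary_node (dom D) i).
Hypothesis Bb : ctrlB D b.

Lemma vtx_cylB : cylB D (tgrid dt n, vtx M i, b).
Proof. by split=> //; exact: htime. Qed.

Lemma kB_denominator_ge1 : 1 <= 1 + ell * kB D (tgrid dt n) (vtx M i) b.
Proof.
rewrite lerDl mulr_ge0 ?(ltW ell_gt0)//.
by apply: (sa_k_ge0 hD); exact: vtx_cylB.
Qed.

(** The denominator 1 + ell k is at least 1, so dividing shrinks the
    constant c. *)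
Lemma S_bd_b_leD (V W : 'I_(nv M) -> R) c :
    0 <= c -> (forall j, V j <= W j + c) ->
  S_bd_b n i b V <= S_bd_b n i b W + c.
Proof.
move=> c0 VW; rewrite /Defs.S_bd_b.
have den1 := kB_denominator_ge1.
have den0 := lt_le_trans ltr01 den1.
rewrite ler_pdivrMr// mulrDl divfK ?gt_eqF// addrAC lerD2r.
apply: (@le_trans _ _
  (interp W (vtx M i - ell *: gamma D (vtx M i) b) + c)).
  apply: (interp_leD hnodal hexact hpoly) => //.
  by apply: subset_closure; exact: hoffset.
by rewrite lerD2l ler_peMr.
Qed.

Lemma S_bd_b0_ge (G : R) : 0 <= G ->
    (forall t x b, cylB D (t, x, b) -> - G <= gB D t x b) ->
  - (ell * G) <= S_bd_b n i b (fun=> 0).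
Proof.
move=> G0 gG; rewrite /Defs.S_bd_b.
have den1 := kB_denominator_ge1.
rewrite ler_pdivlMr; last exact: lt_le_trans den1.
rewrite /interp big1 ?add0r; last by move=> j _; rewrite mulr0.
apply: (@le_trans _ _ (- (ell * G))).
  by rewrite mulNr lerN2 ler_peMr// mulr_ge0// ltW.
by rewrite -mulrN ler_wpM2l ?(ltW ell_gt0)//; apply: gG; exact: vtx_cylB.
Qed.

End BoundaryNode.

Lemma S_intE n i (V : 'I_(nv M) -> R) : S_int n i V =
  inf [set S_ab n i z.1 z.2 V | z in ctrlA D `*` ctrlB D].
Proof.
rewrite /Defs.S_int; congr inf; apply/seteqP; split=> [z [a [b [Aa Bb ->]]]|].
  by exists (a, b).
by move=> _ [[a b] [/= Aa Bb] <-]; exists a, b.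
Qed.

Lemma ctrlAB_nonempty : ctrlA D `*` ctrlB D !=set0.
Proof.
have [a Aa] := sa_A_nonempty hD; have [b Bb] := sa_B_nonempty hD.
by exists (a, b).
Qed.

Lemma addr_sum_norm_ge0 (V : 'I_(nv M) -> R) j : 0 <= V j + \sum_k `|V k|.
Proof.
rewrite (bigD1 j)//= addrA addr_ge0//; last exact: sumr_ge0.
by rewrite -lerBlDl sub0r ler_normr lexx orbT.
Qed.

(** Since 0 <= V + sum |V j|, the comparison bounds the values at V by those at
    0, up to a constant that does not depend on the controls. *)
Lemma S_ab_has_lbound n i (V : 'I_(nv M) -> R) :
    (n < NT)%N -> interior_node (dom D) i ->
  has_lbound [set S_ab n i z.1 z.2 V | z in ctrlA D `*` ctrlB D].
Proof.
move=> nNT inti.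
have [F _ fF] := fA_lower_bound hD; have [G G0 gG] := gB_lower_bound hD.
exists (- (2 * op_delta Q * G + dt * F) - \sum_k `|V k|).
move=> _ [[a b] [/= Aa Bb] <-]; rewrite lerBlDr.
apply: (le_trans (S_ab0_ge nNT inti Aa Bb G0 fF gG)).
by apply: S_ab_leD => //; [exact: sumr_ge0|exact: addr_sum_norm_ge0].
Qed.

Lemma S_bd_b_has_lbound n i (V : 'I_(nv M) -> R) :
    (n < NT)%N -> boundary_node (dom D) i ->
  has_lbound [set S_bd_b n i b V | b in ctrlB D].
Proof.
move=> nNT bdi; have [G G0 gG] := gB_lower_bound hD.
exists (- (ell * G) - \sum_k `|V k|).
move=> _ [b Bb <-]; rewrite lerBlDr.
apply: (le_trans (S_bd_b0_ge nNT bdi Bb G0 gG)).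
by apply: S_bd_b_leD => //; [exact: sumr_ge0|exact: addr_sum_norm_ge0].
Qed.

Lemma S_int_leD n i (V W : 'I_(nv M) -> R) c :
    (n < NT)%N -> interior_node (dom D) i ->
    0 <= c -> (forall j, V j <= W j + c) ->
  S_int n i V <= S_int n i W + c.
Proof.
move=> nNT inti c0 VW; rewrite !S_intE; apply: inf_image_leD.
- exact: ctrlAB_nonempty.
- exact: S_ab_has_lbound.
- by move=> [a b] [/= Aa Bb]; exact: S_ab_leD.
Qed.

Lemma S_bd_leD n i (V W : 'I_(nv M) -> R) c :
    (n < NT)%N -> boundary_node (dom D) i ->
    0 <= c -> (forall j, V j <= W j + c) ->
  S_bd n i V <= S_bd n i W + c.
Proof.
move=> nNT bdi c0 VW; apply: inf_image_leD.
- exact: sa_B_nonempty hD.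
- exact: S_bd_b_has_lbound.
- by move=> b Bb; exact: S_bd_b_leD.
Qed.

Lemma S_int_ge0 n i (V : 'I_(nv M) -> R) :
    (n < NT)%N -> interior_node (dom D) i ->
    (forall t x a, cylA D (t, x, a) -> 0 <= fA D t x a) ->
    (forall t x b, cylB D (t, x, b) -> 0 <= gB D t x b) ->
  (forall j, 0 <= V j) -> 0 <= S_int n i V.
Proof.
move=> nNT inti f0 g0 V0.
have : S_int n i (fun=> 0) <= S_int n i V + 0.
  by apply: S_int_leD => // j; rewrite addr0.
rewrite addr0; apply: le_trans; rewrite S_intE; apply: lb_le_inf.
  by have [z Pz] := ctrlAB_nonempty; exists (S_ab n i z.1 z.2 (fun=> 0)), z.
move=> _ [[a b] [/= Aa Bb] <-].
have := @S_ab0_ge n i a b nNT inti Aa Bb 0 0 (lexx 0).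
by rewrite !mulr0 addr0 oppr0; apply.
Qed.

Lemma S_bd0_ge0 n (i : 'I_(nv M)) : (n < NT)%N -> boundary_node (dom D) i ->
    (forall t x b, cylB D (t, x, b) -> 0 <= gB D t x b) ->
  0 <= S_bd n i (fun=> 0).
Proof.
move=> nNT bdi g0; apply: lb_le_inf.
  by have [b Bb] := sa_B_nonempty hD; exists (S_bd_b n i b (fun=> 0)), b.
move=> _ [b Bb <-]; have := @S_bd_b0_ge n i b nNT bdi Bb 0 (lexx 0).
by rewrite mulr0 oppr0; apply.
Qed.

(** * The implicit system for the boundary values *)

Lemma boundary_nodeN (i : 'I_(nv M)) :
  boundary_node (dom D) i <-> ~ interior_node (dom D) i.
Proof.
rewrite /boundary_node /interior_node /bdry.
rewrite (proj1 (interior_id _) (sa_dom_open hD)).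
by split=> [[]|notin]; last split.
Qed.

(** The right-hand side of the system for one layer on all nodes at once, so
    that solutions of the layer are exactly fixed points. *)
Definition boundary_map n (Z U : 'I_(nv M) -> R) (i : 'I_(nv M)) : R :=
  if `[< interior_node (dom D) i >] then Z i else S_bd n i U.

Lemma boundary_solutionP n (Z U : 'I_(nv M) -> R) :
  boundary_solution D dt ell n Z U <-> boundary_map n Z U = U.
Proof.
rewrite /boundary_map; split=> [[Uint Ubd]|UE].
  apply/funext => i; case: asboolP => [/Uint ->//|].
  by move=> /boundary_nodeN /Ubd.
split=> i Hi; rewrite -[in LHS]UE; first by rewrite asboolT.
by rewrite asboolF//; exact/boundary_nodeN.
Qed.

(** Comparison with the implicitly defined boundary values, resting on
    uniqueness in place of a contraction estimate. *)
Lemma boundary_subsolution_le n (Z U X : 'I_(nv M) -> R) : (n < NT)%N ->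
    (exists! U', boundary_solution D dt ell n Z U') ->
    boundary_solution D dt ell n Z U ->
    (forall i, interior_node (dom D) i -> X i <= Z i) ->
    (forall i, boundary_node (dom D) i -> X i <= S_bd n i X) ->
  forall i, X i <= U i.
Proof.
move=> nNT [U' [_ U'uniq]] solU Xint Xbd.
apply: (@post_fixed_point_le _ _ (boundary_map n Z)).
- move=> V W c c0 VW i; rewrite /boundary_map; case: asboolP => [_|].
    by rewrite lerDl.
  by move=> /boundary_nodeN bdi; exact: S_bd_leD.
- exact/boundary_solutionP.
- by move=> V /boundary_solutionP /U'uniq <-; exact: U'uniq.
- move=> i; rewrite /boundary_map; case: asboolP => [/Xint//|].
  by move=> /boundary_nodeN /Xbd.
Qed.

(** The update of V is a subsolution of the system that defines the update of
    W, because its interior data S_int V lie below S_int W. *)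
Lemma layer_update_le n (V W : 'I_(nv M) -> R) : (n < NT)%N ->
    boundary_uniquely_solvable D M dt ell NT -> (forall j, V j <= W j) ->
  forall i, layer_update D Q dt ell n V i <= layer_update D Q dt ell n W i.
Proof.
move=> nNT solv VW.
have sol (X : 'I_(nv M) -> R) :
    boundary_solution D dt ell n (fun i => S_int n i X)
      (layer_update D Q dt ell n X).
  have [U [solU _]] := solv n (fun i => S_int n i X) nNT.
  exact: (xgetI _ solU).
have [Vint Vbd] := sol V.
apply: (boundary_subsolution_le nNT (solv _ _ nNT) (sol W)) => i Hi.
  rewrite Vint// -[leRHS]addr0; apply: S_int_leD => // j.
  by rewrite addr0.
by rewrite -Vbd.
Qed.

(** Backward induction on the level: when the next level is nonnegative, the
    zero vector is a subsolution of the current layer. *)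
Lemma discrete_solution_ge0 (U : nat -> 'I_(nv M) -> R) :
    boundary_uniquely_solvable D M dt ell NT ->
    (forall t x a, cylA D (t, x, a) -> 0 <= fA D t x a) ->
    (forall t x b, cylB D (t, x, b) -> 0 <= gB D t x b) ->
    (forall x, closure (dom D) x -> 0 <= Psi D x) ->
    discrete_solution D Q dt ell NT U ->
  forall n i, (n <= NT)%N -> 0 <= U n i.
Proof.
move=> solv f0 g0 Psi0 [Ufin Ustep] n i nNT.
(* Induction on the number m of steps back from the final time. *)
rewrite -(subKn nNT); move: (NT - n)%N (leq_subr n NT) i => {n nNT} m.
elim: m => [_ i|m IHm mNT]; first by rewrite subn0 Ufin Psi0.
set n := (NT - m.+1)%N.
have nS : (NT - m)%N = n.+1 by rewrite /n subnSK.
have nNT : (n < NT)%N by rewrite -nS leq_subr.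
have [Uint Ubd] := Ustep _ nNT.
have Un1 j : 0 <= U n.+1 j by rewrite -nS; apply: IHm; exact: ltnW.
apply: (boundary_subsolution_le nNT (solv _ (U n) nNT)) => // i Hi.
  by rewrite Uint// S_int_ge0.
exact: S_bd0_ge0.
Qed.

End Comparison.

Theorem proposition4p1 (R : realType) (N Np NA NB : nat)
    (D : data R N Np NA NB) (Q : oblique_proj R N NB)
    (H : set R) (Mh : R -> mesh R N) (c0 c1 : R) (ell : R -> R)
    (hD : standing_assumptions D)
    (hQ : oblique_projection D Q)
    (hM : mesh_family (dom D) H Mh)
    (hc : 0 < c0 <= c1)
    (hell : forall h, H h -> c0 * h <= ell h <= c1 * h)
    (h : R) (hH : H h) (NT : nat) (hNT : (0 < NT)%N) (dt : R)
    (hdt : dt = horizon D / NT%:R)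
    (hbranch : branches_well_defined D Q (Mh h) dt NT)
    (hoffset : offsets_well_defined D (Mh h) (ell h))
    (hsolv : boundary_uniquely_solvable D (Mh h) dt (ell h) NT) :
  [/\ (* monotonicity *)
      forall V W : 'I_(nv (Mh h)) -> R, (forall j, V j <= W j) ->
        forall n, (n < NT)%N ->
        [/\ forall i a b, interior_node (dom D) i -> ctrlA D a -> ctrlB D b ->
              S_ab D Q dt n i a b V <= S_ab D Q dt n i a b W,
            forall i, interior_node (dom D) i ->
              S_int D Q dt n i V <= S_int D Q dt n i W,
            forall i b, boundary_node (dom D) i -> ctrlB D b ->
              S_bd_b D dt (ell h) n i b V <= S_bd_b D dt (ell h) n i b W,
            forall i, boundary_node (dom D) i ->
              S_bd D dt (ell h) n i V <= S_bd D dt (ell h) n i W &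
            forall i,
              layer_update D Q dt (ell h) n V i
              <= layer_update D Q dt (ell h) n W i],
      (* addition of nonnegative constants *)
      forall (V : 'I_(nv (Mh h)) -> R) (c : R), 0 <= c ->
        forall n, (n < NT)%N ->
        (forall i, interior_node (dom D) i ->
           S_int D Q dt n i (fun j => V j + c) <= S_int D Q dt n i V + c) /\
        (forall i, boundary_node (dom D) i ->
           S_bd D dt (ell h) n i (fun j => V j + c)
           <= S_bd D dt (ell h) n i V + c) &
      (* nonnegativity of the discrete solution *)
      (forall t x a, cylA D (t, x, a) -> 0 <= fA D t x a) ->
      (forall t x b, cylB D (t, x, b) -> 0 <= gB D t x b) ->
      (forall x, closure (dom D) x -> 0 <= Psi D x) ->
      forall U : nat -> 'I_(nv (Mh h)) -> R,
        discrete_solution D Q dt (ell h) NT U ->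
        forall n i, (n <= NT)%N -> 0 <= U n i].
Proof.
have h0 := mf_gt0 hM hH.
have T0 := sa_horizon hD.
have [hnodal hexact] := (mf_nodal hM hH, mf_exact hM hH).
have [hpoly hvtx] := (mf_poly_map hM hH, mf_vertices hM hH).
have NT0 : 0 < NT%:R :> R by rewrite ltr0n.
have dt0 : 0 <= dt by rewrite hdt divr_ge0 ?ltW.
have ell0 : 0 < ell h.
  have /andP[c00 _] := hc; have /andP[+ _] := hell h hH.
  by apply: lt_le_trans; rewrite mulr_gt0.
have htime n : (n < NT)%N -> time_ok D (tgrid dt n).
  move=> nNT; rewrite /time_ok /tgrid mulr_ge0//= hdt mulrCA.
  by rewrite ler_piMr ?ltW// ltr_pdivrMr// mul1r ltr_nat.
split.
- move=> V W VW n nNT.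
  have VW0 j : V j <= W j + 0 by rewrite addr0.
  split.
  + move=> i a b inti Aa Bb; rewrite -[leRHS]addr0.
    exact: (S_ab_leD (NT := NT)).
  + move=> i inti; rewrite -[leRHS]addr0; exact: (S_int_leD (NT := NT)).
  + move=> i b bdi Bb; rewrite -[leRHS]addr0; exact: (S_bd_b_leD (NT := NT)).
  + move=> i bdi; rewrite -[leRHS]addr0; exact: (S_bd_leD (NT := NT)).
  + exact: (layer_update_le (NT := NT)).
- move=> V c c_ge0 n nNT; split=> i Hi.
  + exact: (S_int_leD (NT := NT)).
  + exact: (S_bd_leD (NT := NT)).
- by move=> f0 g0 Psi0 U; exact: (discrete_solution_ge0 (NT := NT)).
Qed.
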